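(* Let $n>1$ be an integer. If $8$ divides $n$, then the dihedral group $D_{2n}$ of order $2n$ is not a filled group. In particular, the only filled dihedral $2$-groups are $D_4$ and $D_8$.
   Context: For $n>1$, $D_{2n}=\langle x,y \mid x^n=y^2=1,\ xy=yx^{-1}\rangle$ is the dihedral group of order $2n$ (so $D_4\cong C_2\times C_2$). For subsets $S,V$ of a group $G$, $SV=\{sv : s\in S, v\in V\}$. A non-empty subset $S$ of a finite group $G$ is product-free if $S\cap SS=\varnothing$. A product-free set $S$ is locally maximal if whenever $T$ is a product-free subset of $G$ with $S\subseteq T$, then $S=T$. $G^*$ denotes the set of non-identity elements of $G$. A subset $S$ of $G$ fills $G$ if $G^*\subseteq S\cup SS$. $G$ is a filled group if every locally maximal product-free set in $G$ fills $G$. *)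

(* Defs.v *)
From mathcomp Require Import all_boot all_fingroup all_solvable.

Set Implicit Arguments.
Unset Strict Implicit.
Unset Printing Implicit Defensive.

Local Open Scope group_scope.

Section Filled.

Variables (gT : finGroupType) (G : {group gT}).
Implicit Type S : {set gT}.

Definition product_free : pred {set gT} :=
  fun S => [&& S != set0, S \subset G & [disjoint S & S * S]].

Definition locally_maximal : pred {set gT} :=
  fun S => maxset product_free S.

Definition fills : pred {set gT} :=
  fun S => (S \subset G) && (G^# \subset S :|: S * S).

Definition filled : bool := [forall S, locally_maximal S ==> fills S].

End Filled.

(* Main.v *)
(* Filledness passes to homomorphic images: the full preimage of a locally
   maximal product-free set is again one, and if it fills then so does its
   image. If 8 divides n then D_{2n} maps onto D_16, so the positive and
   negative claims reduce to D_4, D_8 and D_16. These are settled by running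
   over sublists of a multiplication table, respectively by one explicit set. *)

Require Import Defs.
From mathcomp Require Import all_boot all_fingroup all_solvable.

Set Implicit Arguments.
Unset Strict Implicit.
Unset Printing Implicit Defensive.

Local Open Scope group_scope.

(** * Product-free sets and their one-point extensions *)

Section ProductFree.

Variables (gT : finGroupType) (G : {group gT}).
Implicit Type S : {set gT}.

Lemma product_freeP S :
  reflect [/\ S != set0, S \subset G &
              forall a b, a \in S -> b \in S -> a * b \notin S]
          (product_free G S).
Proof.
apply: (iffP and3P) => [] [S0 SG dS]; split=> //.
  by move=> a b Sa Sb; apply: contraTN (mem_mulg Sa Sb) => /(disjointFr dS) ->.
rewrite disjoint_sym disjoint_subset; apply/subsetP=> _ /mulsgP[a b Sa Sb ->].
exact: dS.
Qed.

(** Non-empty subsets of product-free sets are product-free, so a proper product-free extension of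
    [S] already yields one with a single extra element. Maximality becomes a check over elements
    instead of over subsets. *)
Lemma locally_maximalE S :
  locally_maximal G S =
    product_free G S && [forall g in G :\: S, ~~ product_free G (g |: S)].
Proof.
apply/maxsetP/andP=> [[pfS maxS] | [pfS /forall_inP nextS]].
  split=> //; apply/forall_inP=> g /setDP[_ S'g]; apply: contra S'g => pfgS.
  by rewrite -(maxS _ pfgS (subsetUr _ _)) setU11.
split=> // U pfU sSU; apply/eqP; rewrite eqEsubset sSU andbT.
have [U0 UG mU] := product_freeP _ pfU.
apply/subsetP=> g Ug; apply: contraT => S'g.
have sgSU: g |: S \subset U by rewrite subUset sub1set Ug.
have /nextS/negP[] : g \in G :\: S by rewrite inE S'g (subsetP UG).
apply/product_freeP; split; first by apply/set0Pn; exists g; rewrite setU11.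
  exact: subset_trans sgSU UG.
move=> a b /(subsetP sgSU) Ua /(subsetP sgSU) Ub.
exact: contra (subsetP sgSU _) (mU a b Ua Ub).
Qed.

End ProductFree.

(** * Homomorphic images of filled groups *)

Lemma filled_morphim (aT rT : finGroupType) (G : {group aT})
  (f : {morphism G >-> rT}) : filled G -> filled (f @* G).
Proof.
move=> /forallP fillG; apply/forallP=> S; apply/implyP.
rewrite locally_maximalE => /andP[/product_freeP[/set0Pn[s0 Ss0] SfG mS]].
move=> /forall_inP nextS; set T := f @*^-1 S.
have TP g : g \in G -> (g \in T) = (f g \in S) by move=> Gg; rewrite !inE Gg.
have TG : T \subset G by apply: subsetIl.
have lift s : s \in S -> exists2 t, t \in T & f t = s.
  move=> Ss; have /morphimP[t Gt _ ft] := subsetP SfG _ Ss.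
  by exists t; rewrite ?TP -?ft.
have [t0 Tt0 ft0] := lift _ Ss0.
have pfT : product_free G T.
  apply/product_freeP; split=> //; first by apply/set0Pn; exists t0.
  move=> a b Ta Tb; have Ga := subsetP TG _ Ta; have Gb := subsetP TG _ Tb.
  by move: Ta Tb; rewrite !TP ?groupM ?morphM //; apply: mS.
(* If [g |: T] were product-free for some [g] outside [T], then so would be [f g |: S], against the
   maximality of [S]. *)
have lmT : locally_maximal G T.
  rewrite locally_maximalE pfT; apply/forall_inP=> g /setDP[Gg T'g].
  apply/negP=> /product_freeP[_ _ mgT].
  have gT : g \in g |: T by rewrite setU11.
  have inT t : t \in T -> t \in g |: T by move=> Tt; rewrite setU1r.
  (* An element [g] of the kernel would keep [g * t0] in the fibre of [s0], hence in [T]. *)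
  have fg1 : f g != 1.
    apply/eqP=> fg1; case/negP: (mgT g t0 gT (inT _ Tt0)); apply: inT.
    have Gt0 := subsetP TG _ Tt0.
    by rewrite TP ?groupM // morphM // fg1 mul1g ft0.
  have S1 : 1 \notin S by apply/negP=> S1; have := mS 1 1 S1 S1; rewrite mulg1 S1.
  have /nextS/negP[] : f g \in f @* G :\: S by rewrite inE -TP // T'g mem_morphim.
  apply/product_freeP; split; first by apply/set0Pn; exists (f g); rewrite setU11.
    by rewrite subUset SfG andbT sub1set mem_morphim.
  have lift1 s : s \in f g |: S -> exists2 t, t \in g |: T & f t = s.
    case/setU1P=> [-> | /lift[t Tt <-]]; first by exists g.
    by exists t; rewrite ?inT.
  have sgTG : g |: T \subset G by rewrite subUset sub1set Gg.
  (* Suppose [a * b = f g]. If both factors are [f g], then [f g = 1]; if just one is, the other is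
     1 and lies in [S]. *)
  move=> a b Sa Sb; apply/negP=> /setU1P[abg | Sab].
    case/setU1P: Sa => [Ea | Sa].
      case/setU1P: Sb => [Eb | Sb].
        by case/eqP: fg1; apply: (mulgI a); rewrite mulg1 -{1}Eb abg Ea.
      case/negP: S1; suff <- : b = 1 by [].
      by apply: (mulgI a); rewrite abg mulg1 Ea.
    case/setU1P: Sb => [Eb | Sb].
      case/negP: S1; suff <- : a = 1 by [].
      by apply: (mulIg b); rewrite abg mul1g Eb.
    (* Arbitrary lifts of [a] and [b] multiply to [g] only modulo the kernel. Lifting [b] to
       [a'^-1 * g] makes the product exactly [g]. *)
    have [a' Ta' fa'] := lift a Sa; have Ga' := subsetP TG _ Ta'.
    have Gb' : a'^-1 * g \in G by rewrite groupM ?groupV.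
    suff /inT/(mgT _ _ (inT _ Ta'))/negP[] : a'^-1 * g \in T by rewrite mulKVg.
    by rewrite TP // morphM ?groupV // morphV // fa' -abg mulKg.
  (* Here any lifts will do: [T] is a union of fibres, so it contains every lift of [a * b]. *)
  have [a' Ta' fa'] := lift1 a Sa; have [b' Tb' fb'] := lift1 b Sb.
  have Ga' := subsetP sgTG _ Ta'; have Gb' := subsetP sgTG _ Tb'.
  case/negP: (mgT a' b' Ta' Tb'); apply: inT.
  by rewrite TP ?groupM // morphM // fa' fb'.
have /andP[_ /subsetP fillT] : fills G T by apply: (implyP (fillG T)).
rewrite /fills SfG; apply/subsetP=> h /setD1P[fg1 /morphimP[g Gg _ Eh]].
rewrite {h}Eh in fg1 *.
have /fillT/setUP[] : g \in G^#.
- by rewrite !inE Gg andbT; apply: contraNneq fg1 => ->; rewrite morph1.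
- by rewrite TP // => Sfg; rewrite inE Sfg.
case/mulsgP=> a b Ta Tb ->; have Ga := subsetP TG _ Ta; have Gb := subsetP TG _ Tb.
by apply/setUP; right; rewrite morphM // mem_mulg // -TP.
Qed.

Lemma filled_homg (aT rT : finGroupType) (G : {group aT}) (H : {group rT}) :
  H \homg G -> filled G -> filled H.
Proof.
case/homgP=> f fG; have <- : (f @* G)%G = H by apply: val_inj.
exact: filled_morphim.
Qed.

(** * Filledness by computation in a multiplication table *)

Section MultiplicationTable.

Variables (T : eqType) (els : seq T) (mul : T -> T -> T) (one : T).
Implicit Type s : seq T.

Definition table_product_free s :=
  (s != [::]) && all (fun p => all (fun q => mul p q \notin s) s) s.

Definition table_locally_maximal s :=
  table_product_free s &&
  all (fun g => (g \in s) || ~~ table_product_free (g :: s)) els.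

Definition table_fills s :=
  all (fun g => [|| g == one, g \in s |
                    has (fun p => has (fun q => g == mul p q) s) s]) els.

(** Order is preserved, so a duplicate-free list of length k gives 2^k candidates: 16 for D_4 and
    256 for D_8. *)
Fixpoint sublists s : seq (seq T) :=
  if s is p :: s' then sublists s' ++ map (cons p) (sublists s') else [:: [::]].

Definition table_filled :=
  all (fun s => table_locally_maximal s ==> table_fills s) (sublists els).

Lemma mem_sublists_filter (a : pred T) s : filter a s \in sublists s.
Proof.
elim: s => //= p s IHs; rewrite mem_cat.
by case: (a p); rewrite ?IHs // map_f ?orbT.
Qed.

(** Extending a code by [p] puts [p] in front, whereas the code of the extended set follows the
    order of [els]; the two agree only as sets. *)
Lemma eq_table_product_free s1 s2 :
  s1 =i s2 -> table_product_free s1 = table_product_free s2.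
Proof.
move=> e12; congr (~~ _ && _).
  by case: s1 s2 e12 => [|p s1] [|q s2] // e12;
    [have := e12 q | have := e12 p]; rewrite !inE eqxx.
rewrite (eq_all_r e12); apply: eq_all => p; rewrite (eq_all_r e12).
by apply: eq_all => q; rewrite e12.
Qed.

(** * Transfer to a group along a multiplicative bijection [w] *)

Variables (gT : finGroupType) (G : {group gT}) (w : T -> gT).
Hypothesis mem_w : {in els, forall p, w p \in G}.
Hypothesis w_surj : {in G, forall g, exists2 p, p \in els & g = w p}.
Hypothesis w_inj : {in els &, injective w}.
Hypothesis mem_mul : {in els &, forall p q, mul p q \in els}.
Hypothesis wM : {in els &, {morph w : p q / mul p q >-> p * q}}.
Hypothesis one_els : one \in els.
Hypothesis w1 : w one = 1.

(** As a filter of [els], the code of any set occurs in [sublists els]. *)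
Definition table_code (S : {set gT}) := [seq p <- els | w p \in S].

Lemma table_product_free_code (S : {set gT}) :
  S \subset G -> table_product_free (table_code S) = product_free G S.
Proof.
move=> SG; apply/andP/product_freeP => [[c0 /allP mS] | [/set0Pn[g Sg] _ mS]].
  split=> //.
    case E: (table_code S) c0 => [//|p s] _.
    have: p \in table_code S by rewrite E mem_head.
    by rewrite mem_filter => /andP[Sp _]; apply/set0Pn; exists (w p).
  move=> a b Sa Sb.
  have [p els_p Ea] := w_surj (subsetP SG _ Sa).
  have [q els_q Eb] := w_surj (subsetP SG _ Sb).
  have cp : p \in table_code S by rewrite mem_filter -Ea Sa.
  have cq : q \in table_code S by rewrite mem_filter -Eb Sb.
  by have:= allP (mS p cp) q cq; rewrite mem_filter mem_mul // andbT wM // -Ea -Eb.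
split.
  have [p els_p Eg] := w_surj (subsetP SG _ Sg).
  have: p \in table_code S by rewrite mem_filter -Eg Sg.
  by case: (table_code S).
apply/allP=> p; rewrite mem_filter => /andP[Sp els_p].
apply/allP=> q; rewrite mem_filter => /andP[Sq els_q].
by rewrite mem_filter mem_mul // andbT wM // mS.
Qed.

Lemma table_code_setU1 (S : {set gT}) p :
  p \in els -> table_code (w p |: S) =i p :: table_code S.
Proof.
move=> els_p q; rewrite inE !mem_filter in_setU1 andb_orl; congr (_ || _).
apply/andP/eqP=> [[/eqP e els_q] | ->]; [exact: w_inj | by rewrite eqxx].
Qed.

Lemma table_locally_maximal_code (S : {set gT}) :
  S \subset G -> table_locally_maximal (table_code S) = locally_maximal G S.
Proof.
move=> SG; rewrite locally_maximalE /table_locally_maximal.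
rewrite table_product_free_code //; congr (_ && _).
have next p : p \in els ->
    table_product_free (p :: table_code S) = product_free G (w p |: S).
  move=> els_p; rewrite -(eq_table_product_free (table_code_setU1 S els_p)).
  by rewrite table_product_free_code // subUset sub1set mem_w.
apply/allP/forall_inP=> [nextS g | nextS p els_p].
  case/setDP=> Gg S'g; have [p els_p Eg] := w_surj Gg.
  by have:= nextS p els_p; rewrite next // mem_filter -Eg (negPf S'g).
rewrite mem_filter els_p andbT next //; case: (boolP (w p \in S)) => //= S'p.
by apply: nextS; rewrite inE S'p mem_w.
Qed.

Lemma table_fills_code (S : {set gT}) :
  S \subset G -> table_fills (table_code S) = fills G S.
Proof.
move=> SG; rewrite /fills SG.
apply/allP/subsetP=> [fillS g | fillS p els_p].
  case/setD1P=> g1 Gg; have [p els_p Eg] := w_surj Gg.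
  case/or3P: (fillS p els_p).
  - by move/eqP=> p1; rewrite Eg p1 w1 eqxx in g1.
  - by rewrite mem_filter -Eg => /andP[Sg _]; rewrite inE Sg.
  case/hasP=> a; rewrite mem_filter => /andP[Sa els_a].
  case/hasP=> b; rewrite mem_filter => /andP[Sb els_b] /eqP Ep.
  by rewrite Eg Ep wM // inE mem_mulg ?orbT.
case: eqP => //= p1; rewrite mem_filter els_p andbT.
have /fillS/setUP[] : w p \in G^#.
- rewrite !inE mem_w // andbT; apply/eqP=> wp1; case: p1.
  by apply: w_inj; rewrite // wp1 w1.
- by move=> ->.
case/mulsgP=> g h Sg Sh Ep; apply/orP; right.
have [a els_a Eg] := w_surj (subsetP SG _ Sg).
have [b els_b Eh] := w_surj (subsetP SG _ Sh).
apply/hasP; exists a; first by rewrite mem_filter -Eg Sg.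
apply/hasP; exists b; first by rewrite mem_filter -Eh Sh.
by apply/eqP/w_inj; rewrite ?mem_mul // wM // -Eg -Eh.
Qed.

Lemma table_filled_filled : table_filled -> filled G.
Proof.
move=> /allP fillG; apply/forallP=> S; apply/implyP=> lmS.
have SG : S \subset G.
  by move: lmS; rewrite locally_maximalE => /andP[/product_freeP[]].
have:= fillG _ (mem_sublists_filter (fun p => w p \in S) els).
by rewrite table_locally_maximal_code // lmS /= table_fills_code.
Qed.

(** Filtering puts the witness in the order of [els], so that [c] is literally the [table_code] of a
    subset of [G]. *)
Lemma table_not_filled (s : seq T) (c := [seq p <- els | p \in s]) :
  table_locally_maximal c -> ~~ table_fills c -> ~~ filled G.
Proof.
set S := [set g | has (fun p => w p == g) c].
have SG : S \subset G.
  apply/subsetP=> g; rewrite inE => /hasP[p]; rewrite mem_filter.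
  by case/andP=> _ els_p /eqP<-; apply: mem_w.
have <- : table_code S = c.
  apply: eq_in_filter => p els_p; rewrite inE.
  apply/hasP/idP=> [[q] | sp]; last by exists p; rewrite // mem_filter sp.
  by rewrite mem_filter => /andP[sq els_q] /eqP/w_inj <-.
rewrite table_locally_maximal_code // table_fills_code // => lmS nfillS.
by apply: contra nfillS => /forallP/(_ S)/implyP; apply.
Qed.

End MultiplicationTable.

(** * The multiplication table of a dihedral group *)

(* The pair [(i, e)] stands for [x ^+ i * y ^+ e]. *)
Section DihedralTable.

Variable q : nat.
Hypothesis q_gt1 : q > 1.

Definition dihedral_els : seq (nat * bool) :=
  [seq (i, e) | e <- [:: false; true], i <- iota 0 q].

(** Moving [y] past [x ^+ j] inverts the latter. The truncated [q - j] is exact on [dihedral_els],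
    and the reduction modulo [q] absorbs its value [q] at [j = 0]. *)
Definition dihedral_mul (a b : nat * bool) :=
  ((a.1 + (if a.2 then q - b.1 else b.1)) %% q, a.2 (+) b.2).

Lemma mem_dihedral_els a : (a \in dihedral_els) = (a.1 < q).
Proof.
case: a => i e; apply/allpairsP/idP => [[[e' j] /= [_]] | ltiq].
  by rewrite mem_iota => /andP[_ ltjq] [-> _].
exists (e, i); split=> //=; first by case: (e).
by rewrite mem_iota.
Qed.

(** The relations give surjectivity and the product rule. Injectivity follows by counting: [2q]
    words cover a group of order [2q]. *)
Lemma dihedral_wordP :
  exists w : nat * bool -> 'D_q.*2,
  [/\ {in 'D_q.*2, forall g, exists2 a, a \in dihedral_els & g = w a},
      {in dihedral_els &, injective w},
      {in dihedral_els &, {morph w : a b / dihedral_mul a b >-> a * b}}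
    & w (0, false) = 1].
Proof.
have q_gt0 : 0 < q := ltnW q_gt1.
have /existsP[[x y] /=] := isoGrp_hom (Grp_dihedral q_gt1).
case/eqP=> defG xq yq xy.
pose w (a : nat * bool) := x ^+ a.1 * y ^+ a.2.
have wsurj : {in 'D_q.*2, forall g, exists2 a, a \in dihedral_els & g = w a}.
  move=> g; rewrite -defG norm_joinEr ?norms_cycle ?xy ?groupV ?cycle_id //.
  case/mulsgP=> _ _ /cycleP[i ->] /cycleP[j ->] ->.
  exists (i %% q, odd j); first by rewrite mem_dihedral_els ltn_mod.
  by rewrite /w /= (expg_mod _ xq) -modn2 (expg_mod _ yq).
exists w; split=> //; last by rewrite /w mulg1.
- have size_els : size dihedral_els = #|'D_q.*2|.
    by rewrite card_dihedral // size_allpairs size_iota -mul2n.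
  have /(uniqP 1) U : uniq (map w dihedral_els).
    apply: (@leq_size_uniq _ (enum 'D_q.*2)); first exact: enum_uniq.
      by move=> g; rewrite mem_enum => /wsurj[a els_a ->]; rewrite map_f.
    by rewrite size_map size_els cardE leqnn.
  move=> a b els_a els_b wab.
  rewrite -(nth_index a els_a) -(nth_index a els_b); congr nth.
  apply: (U); rewrite ?inE ?size_map ?index_mem //.
  by rewrite !(nth_map a) ?index_mem // !nth_index.
case=> i e [j f] /=; rewrite !mem_dihedral_els /= => ltiq ltjq.
rewrite /w /= (expg_mod _ xq) expgD -!mulgA; congr (_ * _).
have yj k : y ^+ (e (+) k) = y ^+ e * y ^+ k.
  by case: e k => [] [] //=; rewrite ?mulg1 ?mul1g //; rewrite -expgD yq.
rewrite yj !mulgA; congr (_ * _).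
case: e {yj} => /=; last by rewrite mulg1 mul1g.
have -> : x ^+ (q - j) = (x ^+ j)^-1.
  by apply: (mulIg (x ^+ j)); rewrite -expgD subnK ?xq ?mulVg // ltnW.
have yV : y^-1 = y by apply: (mulIg y); rewrite mulVg.
(* The inverse of [x ^+ j] is its conjugate [y * x ^+ j * y], as [y] is an involution. *)
by rewrite -expgVn -xy -conjXg conjgE yV -!mulgA -[y * y]/(y ^+ 2) yq mulg1.
Qed.

Lemma dihedral_filled :
  table_filled dihedral_els dihedral_mul (0, false) -> filled 'D_q.*2.
Proof.
have [w [wsurj winj wM w1]] := dihedral_wordP.
apply: (table_filled_filled _ wsurj winj _ wM) => // [a _|a b _ _|].
- exact: in_setT.
- by rewrite mem_dihedral_els ltn_mod ltnW.
by rewrite mem_dihedral_els ltnW.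
Qed.

Lemma dihedral_not_filled (s : seq (nat * bool))
  (c := [seq a <- dihedral_els | a \in s]) :
  table_locally_maximal dihedral_els dihedral_mul c ->
  ~~ table_fills dihedral_els dihedral_mul (0, false) c ->
  ~~ filled 'D_q.*2.
Proof.
have [w [wsurj winj wM w1]] := dihedral_wordP.
apply: (table_not_filled _ wsurj winj _ wM) => // [a _|a b _ _|].
- exact: in_setT.
- by rewrite mem_dihedral_els ltn_mod ltnW.
by rewrite mem_dihedral_els ltnW.
Qed.

End DihedralTable.

(** * The small cases and the reduction to them *)

Lemma filled_D4 : filled 'D_4.
Proof. by apply: (@dihedral_filled 2) => //; vm_compute. Qed.

Lemma filled_D8 : filled 'D_8.
Proof. by apply: (@dihedral_filled 4) => //; vm_compute. Qed.

(* The witness is {x, x^6, y, x^4 y}, which misses x^3 and x^5. *)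
Lemma not_filled_D16 : ~~ filled 'D_16.
Proof.
pose s := [:: (1%N, false); (6, false); (0, true); (4, true)].
by apply: (@dihedral_not_filled 8 _ s); vm_compute.
Qed.

(** The generators of the smaller group satisfy the relations of the larger one, because
    [x ^+ m = 1] implies [x ^+ n = 1]. *)
Lemma homg_dihedral m n :
  m > 1 -> n > 1 -> m %| n -> 'D_m.*2 \homg 'D_n.*2.
Proof.
move=> m_gt1 n_gt1 /dvdnP[k def_n].
have /existsP[[x y] /=] := isoGrp_hom (Grp_dihedral m_gt1).
rewrite (Grp_dihedral n_gt1) => /eqP[defG xm y2 xy].
apply/existsP; exists (x, y) => /=; rewrite defG y2 xy.
by rewrite def_n mulnC expgM xm expg1n.
Qed.

Theorem proposition4p8 (gT : finGroupType) (G : {group gT}) (n : nat)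
    (n_gt1 : n > 1) (dihG : G \isog 'D_(2 * n)) :
  (8 %| n -> ~~ filled G) /\
  (2.-group G -> (filled G <-> G \isog 'D_4 \/ G \isog 'D_8)).
Proof.
rewrite mul2n in dihG.
have nfill : 8 %| n -> ~~ filled G.
  move=> n8; apply: contra not_filled_D16; apply: filled_homg.
  apply: homg_trans (isog_hom _); last by rewrite isog_sym; apply: dihG.
  exact: (@homg_dihedral 8 n).
split=> // pG; split=> [fillG | [isoG | isoG]].
- have [k nk] : exists k, n = (2 ^ k)%N.
    have : 2.-nat n.
      move: pG; rewrite /pgroup (card_isog dihG) card_dihedral //.
      by rewrite -mul2n pnatM => /andP[].
    by case/p_natP=> k ->; exists k.
  (* The exponent 0 contradicts [n > 1], 1 and 2 give D_4 and D_8, and from 3 on 8 divides [n]. *)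
  case: k nk => [|[|[|k]]] nk; rewrite nk // in n_gt1 dihG nfill.
  + by left.
  + by right.
  by have := nfill (@dvdn_exp2l 2 3 k.+3 isT); rewrite fillG.
- by apply: filled_homg filled_D4; apply: isog_hom.
by apply: filled_homg filled_D8; apply: isog_hom.
Qed.
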